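(* There is no $3$-uniform Šoltés' hypergraph of order $8$.
   Context: A hypergraph $H=(V,E)$ consists of a finite vertex set $V$ and a set $E$ of distinct subsets of $V$ (hyperedges). $H$ is $k$-uniform if every hyperedge has exactly $k$ elements. The order of $H$ is $|V|$. For $u,w\in V$, the distance $d_H(u,w)$ is the least $\ell\ge 0$ such that there are vertices $u=x_0,\dots,x_\ell=w$ with $x_{i-1},x_i$ contained in a common hyperedge for each $i$ ($\infty$ if none exists); $H$ is connected if all distances are finite. $W(H)=\sum_{\{u,w\}\subseteq V,\,u\ne w} d_H(u,w)$. For $v\in V$, $H\setminus v$ has vertex set $V\setminus\{v\}$ and hyperedge set $\{e\in E: v\notin e\}$. A Šoltés' hypergraph is a connected hypergraph $H$ with $W(H\setminus v)=W(H)$ for every $v\in V$. *)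

(* Defs.v *)
From HB Require Import structures.
From mathcomp Require Import all_boot.

Set Implicit Arguments.
Unset Strict Implicit.
Unset Printing Implicit Defensive.

(* Natural numbers extended with infinity, [None] standing for infinity. *)
Definition enat := option nat.

Definition eaddn (a b : enat) : enat :=
  if (a, b) is (Some m, Some n) then Some (m + n) else None.

Lemma eaddnA : associative eaddn.
Proof. by move=> [a|] [b|] [c|] //; rewrite /eaddn addnA. Qed.

Lemma eaddnC : commutative eaddn.
Proof. by move=> [a|] [b|] //; rewrite /eaddn addnC. Qed.

Lemma eadd0n : left_id (Some 0) eaddn.
Proof. by case. Qed.

HB.instance Definition _ :=
  Monoid.isComLaw.Build enat (Some 0) eaddn eaddnA eaddnC eadd0n.

(* The vertex set is a subset of an ambient finite type, so that deleting a
   vertex does not change the type. *)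
Record hypergraph (T : finType) := Hypergraph {
  hverts : {set T};
  hedges : {set {set T}};
  hedges_sub : hedges \subset powerset hverts
}.

Section Hypergraph.
Variable T : finType.
Implicit Types (H : hypergraph T) (u v w : T).

Definition horder H : nat := #|hverts H|.

Definition uniform (k : nat) H : Prop := {in hedges H, forall e : {set T}, #|e| = k}.

Definition hadj H : rel T :=
  fun x y => [exists e in hedges H, (x \in e) && (y \in e)].

(* The tuple lists x_1, ..., x_l; the initial vertex x_0 is u. *)
Definition walk H (l : nat) u w : bool :=
  [exists p : l.-tuple T, path (hadj H) u p && (last u p == w)].

Lemma walkP H u w : reflect (exists l, walk H l u w) (connect (hadj H) u w).
Proof.
apply: (iffP connectP) => [[p pP ->]|[l /existsP[p /andP[pP /eqP <-]]]].
  by exists (size p); apply/existsP; exists (in_tuple p); rewrite pP eqxx.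
by exists p.
Qed.

Definition dist H u w : enat :=
  if walkP H u w is ReflectT walk_uw then Some (ex_minn walk_uw) else None.

Lemma dist_SomeP H u w l :
  dist H u w = Some l <-> walk H l u w /\ forall m, walk H m u w -> l <= m.
Proof.
rewrite /dist; case: walkP => [ex|nex]; last first.
  by split=> // -[wl _]; case: nex; exists l.
case: ex_minnP => m wm minm; split=> [[<-]//|[wl minl]].
by congr Some; apply/eqP; rewrite eqn_leq minm // minl.
Qed.

Lemma dist_NoneP H u w : dist H u w = None <-> forall l, ~~ walk H l u w.
Proof.
rewrite /dist; case: walkP => [ex|nex].
  by split=> // nw; have [l] := ex; rewrite (negPf (nw l)).
by split=> // _ l; apply/negP => wl; apply: nex; exists l.
Qed.

Lemma dist_sym H u w : dist H u w = dist H w u.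
Proof.
have hsym x y : hadj H x y = hadj H y x.
  by apply: eq_existsb => e; rewrite [(x \in e) && _]andbC.
have wsym l x y : walk H l x y -> walk H l y x.
  case/existsP=> p /andP[pP /eqP <-]; apply/existsP.
  have sz : size (rev (belast x p)) == l by rewrite size_rev size_belast size_tuple.
  exists (Tuple sz); rewrite /= rev_path.
  rewrite (eq_path (e' := hadj H)) ?pP /=; last by move=> ? ?; rewrite /= hsym.
  by case: (tval p) => //= a s; rewrite rev_cons last_rcons.
case E: (dist H w u) => [l|].
  case/dist_SomeP: E => wl minl; apply/dist_SomeP; split=> [|m wm].
    exact: wsym.
  exact/minl/wsym.
by apply/dist_NoneP => l; apply: contra (wsym _ _ _) _; move/dist_NoneP: E.
Qed.

Definition hconnected H : Prop :=
  {in hverts H &, forall u w, dist H u w <> None}.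

(* Comparing ranks in the enumeration of T selects each unordered pair of
   distinct vertices exactly once; [dist_sym] makes the choice immaterial. *)
Definition wiener H : enat :=
  \big[eaddn/Some 0]_(u in hverts H)
    \big[eaddn/Some 0]_(w in hverts H | enum_rank u < enum_rank w) dist H u w.

Lemma hdel_subproof H v :
  [set e in hedges H | v \notin e] \subset powerset (hverts H :\ v).
Proof.
apply/subsetP => e; rewrite !inE => /andP[eH ve].
by rewrite subsetD1 ve andbT -powersetE (subsetP (hedges_sub H)).
Qed.

Definition hdel H v : hypergraph T := Hypergraph (hdel_subproof H v).

Definition soltes H : Prop :=
  hconnected H /\ {in hverts H, forall v, wiener (hdel H v) = wiener H}.

End Hypergraph.

(* Main.v *)
(** Let [d] be the distance in [H] and [d_v] the distance in [H \ v], and sum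
    [W(H \ v) = W(H)] over the eight vertices [v].  A pair [u, w] contributes
    [8 d(u, w)] on the right.  Truncating [d_v] at 3, it contributes at most
    [7 d(u, w) + 1] on the left, since only the vertices on a fixed shortest
    walk of hyperedges can increase its distance; at distance 1 the bound drops
    by 2 when [u] and [w] share two hyperedges.  Some [d_v] exceeds 3 only if
    [H \ v] is the chain [uab, abc, cde, dew], which has a single pair at
    distance 4 and Wiener index 38; but then the count gives [W(H) <= 28 + 8].
    Otherwise it gives [W(H) = 28] with every pair in exactly one hyperedge,
    i.e. a Steiner triple system of order 8, which does not exist by parity. *)

Require Import Defs.
From mathcomp Require Import all_boot.
From mathcomp Require Import zify.

Set Implicit Arguments.
Unset Strict Implicit.
Unset Printing Implicit Defensive.

(** * Distances and the Wiener index with natural number values *)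

Lemma big_eaddnE (I : Type) (r : seq I) (P : pred I) (F : I -> enat) :
  \big[eaddn/Some 0]_(i <- r | P i) F i =
  if all (fun i => P i ==> isSome (F i)) r
  then Some (\sum_(i <- r | P i) odflt 0 (F i)) else None.
Proof.
elim: r => [|i r IH]; first by rewrite !big_nil.
rewrite !big_cons /= IH; case: (P i) => //=.
by case: (F i) => [a|] //=; case: ifP.
Qed.

Section Distance.
Variable T : finType.
Implicit Types (H : hypergraph T) (u v w x y z : T) (e : {set T}).

(* Junk value 0 for vertices in different components. *)
Definition ndist H u w : nat := odflt 0 (dist H u w).

(** Summing over ordered pairs, with diagonal terms 0, gives twice the Wiener index of a connected
    hypergraph and avoids any ordering of the vertices. *)
Definition ndist_sum H : nat :=
  \sum_(u in hverts H) \sum_(w in hverts H) ndist H u w.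

Definition codegree H u w : nat :=
  #|[set e in hedges H | (u \in e) && (w \in e)]|.

Lemma ndistC H u w : ndist H u w = ndist H w u.
Proof. by rewrite /ndist dist_sym. Qed.

Lemma walk0 H u : walk H 0 u u.
Proof. by apply/existsP; exists [tuple]; rewrite /= eqxx. Qed.

Lemma walk1 H e u w : e \in hedges H -> u \in e -> w \in e -> walk H 1 u w.
Proof.
move=> eH ue we; apply/existsP; exists [tuple w]; rewrite /= eqxx !andbT.
by apply/existsP; exists e; rewrite eH ue we.
Qed.

Lemma walk_cat H m n u x w : walk H m u x -> walk H n x w -> walk H (m + n) u w.
Proof.
case/existsP=> p /andP[pP /eqP pl] /existsP[q /andP[qP /eqP ql]].
apply/existsP; exists [tuple of p ++ q].
by rewrite /= cat_path last_cat pl pP qP ql eqxx.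
Qed.

Lemma walk_recr H n u w :
  walk H n.+1 u w -> exists2 x, walk H n u x & hadj H x w.
Proof.
case/existsP=> p; case: p => p /= sz.
elim/last_ind: p sz => [|p x _] //; rewrite size_rcons eqSS => sz.
rewrite rcons_path last_rcons => /andP[/andP[pP lx] /eqP <-].
by exists (last u p) => //; apply/existsP; exists (Tuple sz); rewrite /= pP eqxx.
Qed.

Lemma walk_ndist_le H n u w : walk H n u w -> ndist H u w <= n.
Proof.
rewrite /ndist => wn; case E: (dist H u w) => [l|] //=.
by case/dist_SomeP: E => _; apply.
Qed.

Lemma dist_ndist H u w l : walk H l u w -> dist H u w = Some (ndist H u w).
Proof.
rewrite /ndist; case E: (dist H u w) => [m|] //.
by move/dist_NoneP: E => /(_ l)/negPf ->.
Qed.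

Lemma ndistxx H u : ndist H u u = 0.
Proof. by apply/eqP; rewrite -leqn0; apply/walk_ndist_le/walk0. Qed.

Lemma hadj_verts H x y : hadj H x y -> (x \in hverts H) && (y \in hverts H).
Proof.
case/existsP=> e /and3P[/(subsetP (hedges_sub H))]; rewrite powersetE.
by move/subsetP=> sub xe ye; rewrite !sub.
Qed.

Lemma edge_ndist_le H e u w :
  e \in hedges H -> u \in e -> w \in e -> ndist H u w <= 1.
Proof. by move=> eH ue we; apply/walk_ndist_le/(walk1 eH). Qed.

Section Connected.
Variable H : hypergraph T.
Hypothesis conH : hconnected H.

Lemma ndist_walk u w :
  u \in hverts H -> w \in hverts H -> walk H (ndist H u w) u w.
Proof.
move=> uV wV; have := conH uV wV; rewrite /ndist.
by case E: (dist H u w) => [l|] // _; case/dist_SomeP: E.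
Qed.

Lemma ndist_gt0 u w :
  u \in hverts H -> w \in hverts H -> u != w -> 0 < ndist H u w.
Proof.
move=> uV wV; apply: contraR; rewrite -eqn0Ngt => /eqP d0.
have := ndist_walk uV wV; rewrite d0 => /existsP[p /andP[_ /eqP <-]].
by rewrite tuple0.
Qed.

Lemma ndist_triangle x u w : u \in hverts H -> x \in hverts H ->
  w \in hverts H -> ndist H u w <= ndist H u x + ndist H x w.
Proof.
by move=> uV xV wV; apply/walk_ndist_le/(@walk_cat _ _ _ _ x); apply: ndist_walk.
Qed.

(** The vertex [x] is the penultimate one on a shortest walk; by the triangle inequality it cannot
    be closer to [u] than [n]. *)
Lemma ndist_pred n u w : u \in hverts H -> w \in hverts H ->
  ndist H u w = n.+1 -> exists2 x, ndist H u x = n & hadj H x w.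
Proof.
move=> uV wV d; have := ndist_walk uV wV; rewrite d => /walk_recr[x ux xw].
exists x => //; apply/eqP; rewrite eqn_leq walk_ndist_le //=.
have [xV _] := andP (hadj_verts xw).
have xw1 : ndist H x w <= 1.
  by case/existsP: xw => e /and3P[eH xe we]; apply: edge_ndist_le eH xe we.
have := ndist_triangle uV xV wV; lia.
Qed.

Lemma ndist1_hadj u w : u \in hverts H -> w \in hverts H ->
  ndist H u w = 1 -> hadj H u w.
Proof.
move=> uV wV /(ndist_pred uV wV)[x ux xw].
have [xV _] := andP (hadj_verts xw).
suff -> : u = x by [].
by apply/eqP/contraT => /(ndist_gt0 uV xV); rewrite ux.
Qed.

(** Replacing [w] by a predecessor lowers its distance from [u] by exactly one, so no smaller value
    is skipped. *)
Lemma ndist_pred_gt n u w : u \in hverts H -> w \in hverts H ->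
  n <= ndist H u w -> exists2 x, x \in hverts H & ndist H u x = n.
Proof.
move=> uV; have [k] := ubnP (ndist H u w - n).
elim: k w => // k IH w lk wV; rewrite leq_eqVlt => /predU1P[->|nlt].
  by exists w.
case E: (ndist H u w) nlt lk => [|m] //= nlt lk.
have [x ux /hadj_verts/andP[xV _]] := ndist_pred uV wV E.
by apply: (IH x) => //; lia.
Qed.

End Connected.

(** A finite sum controls only pairs of increasing rank; symmetry of the distance supplies the
    others. Applied to a vertex deletion, this derives its connectedness from its finite Wiener
    index. *)
Lemma wiener_Some H N : wiener H = Some N ->
  hconnected H /\ ndist_sum H = N.*2.
Proof.
rewrite /wiener big_eaddnE; case: ifP => // /allP allS [EN].
have sm (u w : T) : u \in hverts H -> w \in hverts H ->
    enum_rank u < enum_rank w -> isSome (dist H u w).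
  move=> uV wV lt; have := allS u (mem_index_enum _).
  rewrite uV /= big_eaddnE; case: ifP => // /allP/(_ w (mem_index_enum _)).
  by rewrite wV lt.
have con : hconnected H.
  move=> u w uV wV; case: (ltngtP (enum_rank u) (enum_rank w)) => [lt|gt|/val_inj/enum_rank_inj <-].
  - by have := sm _ _ uV wV lt; case: dist.
  - by have := sm _ _ wV uV gt; rewrite dist_sym; case: dist.
  - by rewrite (dist_ndist (walk0 H u)).
split=> //; rewrite -EN /ndist_sum.
have Ein u : u \in hverts H ->
  odflt 0 (\big[eaddn/Some 0]_(w in hverts H | enum_rank u < enum_rank w) dist H u w)
  = \sum_(w in hverts H | enum_rank u < enum_rank w) ndist H u w.
  move=> uV; rewrite big_eaddnE; case: allP => // -[] w _.
  by apply/implyP=> /andP[wV lt]; apply: sm.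
rewrite (eq_bigr _ Ein) -addnn.
(* Transposing the second copy turns it into the sum over pairs of decreasing rank, up to
   [ndistC]. *)
rewrite [X in _ = _ + X](exchange_big_dep (mem (hverts H))) /=; last by move=> u w _ /andP[].
rewrite -big_split /=; apply: eq_bigr => u uV.
rewrite (bigID (fun w => enum_rank u < enum_rank w)) /=; congr addn.
rewrite (bigD1 u) /= ?uV ?ltnn // ndistxx add0n.
apply: eq_big => [w|w _]; last exact: ndistC.
rewrite -andbA -leqNgt [enum_rank w < _]ltn_neqAle andbC -andbA /=.
by rewrite (inj_eq val_inj) (inj_eq enum_rank_inj) andbCA andbA andbC.
Qed.

Lemma hconnected_wiener H : hconnected H -> exists N, wiener H = Some N.
Proof.
move=> con; rewrite /wiener big_eaddnE; case: allP => [_|[]]; first by eexists.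
move=> u _; apply/implyP => uV; rewrite big_eaddnE; case: allP => // -[] w _.
by apply/implyP => /andP[wV _]; have := con u w uV wV; case: dist.
Qed.

Lemma uniform3_third H e x y : uniform 3 H -> e \in hedges H -> x != y ->
  x \in e -> y \in e ->
  exists z, [/\ e = [set x; y; z], z != x & z != y].
Proof.
move=> un eH xy xe ye; have := un e eH.
rewrite (cardsD1 x) xe (cardsD1 y) !inE eq_sym xy ye /= !add1n => -[] /eqP/cards1P[z Ez].
have : z \in e :\ x :\ y by rewrite Ez set11.
rewrite !inE => /and3P[zy zx ze]; exists z; split=> //.
have yex : y \in e :\ x by rewrite !inE eq_sym xy.
by rewrite -(setD1K xe) -(setD1K yex) Ez setUA.
Qed.

End Distance.

(** * Connected 3-uniform hypergraphs of order 7 *)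

Lemma cardsD1_in (T : finType) (A : {set T}) x n :
  #|A| = n.+1 -> x \in A -> #|A :\ x| = n.
Proof. by move=> cA xA; have := cardsD1 x A; rewrite xA cA add1n => -[]. Qed.

(* The distance layers around [u] have sizes 1, 2, 1, 2, 1: two consecutive
   layers contain a hyperedge, so their sizes add up to at least 3. *)
Lemma diameter4_order7 (T : finType) (H : hypergraph T) :
  uniform 3 H -> hconnected H -> horder H = 7 ->
  (exists u w, [/\ u \in hverts H, w \in hverts H & 3 < ndist H u w]) ->
  exists u a b c d e w : T,
    let s := [:: u; a; b; c; d; e; w] in
    [/\ uniq s, hverts H =i s,
        [/\ ndist H u a = 1, ndist H u b = 1, ndist H u c = 2, ndist H u d = 3
          & ndist H u e = 3],
        ndist H u w = 4 &
        [/\ [set u; a; b] \in hedges H, [set a; b; c] \in hedges H,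
            [set c; d; e] \in hedges H & [set d; e; w] \in hedges H]].
Proof.
move=> un con ord [u [w0 [uV w0V lt3]]].
(* The hyperedge through [w] and its predecessor [x] has a third vertex [z], which lies in layer [n]
   or [n.+1] because it is adjacent to both. *)
have step n w : w \in hverts H -> ndist H u w = n.+1 ->
  exists x z, [/\ ndist H u x = n, x \in hverts H, z \in hverts H,
    [set w; x; z] \in hedges H & [/\ n <= ndist H u z, ndist H u z <= n.+1,
    z != w & z != x]].
  move=> wV dw; have [x dx xw] := ndist_pred con uV wV dw.
  have [xV _] := andP (hadj_verts xw).
  have nwx : w != x by apply/eqP => E; move: dw; rewrite E dx => /n_Sn.
  case/existsP: xw => e /and3P[eH xe we].
  have [z [Ee zw zx]] := uniform3_third un eH nwx we xe.
  have ze : z \in e by rewrite Ee !inE eqxx orbT.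
  have zV : z \in hverts H.
    by apply: (subsetP _ _ ze); rewrite -powersetE (subsetP (hedges_sub H)).
  exists x, z; split=> //; first by rewrite -Ee.
  have := edge_ndist_le eH we ze; have := edge_ndist_le eH ze xe.
  have := ndist_triangle con uV xV zV; have := ndist_triangle con uV zV wV.
  rewrite (ndistC _ z w) (ndistC _ z x) dx dw.
  by move=> t1 t2 xz wz; split=> //; move: t1 t2 xz wz; clear; lia.
have [w wV dw] := ndist_pred_gt con uV w0V lt3.
have [d [e [dd dV eV Ewde [e3 e4 new ned]]]] := step _ _ wV dw.
have [c [r [dc cV rV Edcr [r2 r3 nrd nrc]]]] := step _ _ dV dd.
have [a [s [da aV sV Ecas [s1 s2 nsc nsa]]]] := step _ _ cV dc.
have [u' [b [du' u'V bV Eaub [_ b1 nba nbu']]]] := step _ _ aV da.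
have Eu : u' = u.
  by apply/eqP/contraT; rewrite eq_sym => /(ndist_gt0 con uV u'V); rewrite du'.
subst u'; have := ndist_gt0 con uV bV; rewrite eq_sym => /(_ nbu') b0.
have db : ndist H u b = 1 by apply/eqP; rewrite eqn_leq b1 b0.
have du := ndistxx H u.
have ne x y : ndist H u x < ndist H u y -> x != y.
  by apply: contraTneq => ->; rewrite ltnn.
have us : uniq [:: u; a; b; c; d; e; w].
  rewrite /= !inE !negb_or (eq_sym a b) nba (eq_sym d e) ned new /=.
  by rewrite !ne ?du ?da ?db ?dc ?dd ?dw // (leq_trans _ e3).
(* Seven distinct vertices fill [hverts H], so the third vertices [r] and [s] are already listed;
   their layers leave only [e] and [b]. *)
have Vs : hverts H =i [:: u; a; b; c; d; e; w].
  apply/fsym/(subset_cardP _ _); last first.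
    by apply/subsetP=> x; rewrite !inE => /or4P[|||/or4P[]] /eqP->.
  by rewrite (card_uniqP us) /=; apply/esym.
have Er : r = e.
  move: rV r2 r3 nrd nrc; rewrite Vs !inE.
  by case/or4P=> [|||/or4P[]] /eqP-> //; rewrite ?eqxx ?du ?da ?db ?dw.
have Es : s = b.
  subst r; move: sV s1 s2 nsc nsa; rewrite Vs !inE.
  case/or4P=> [|||/or4P[]] /eqP-> //; rewrite ?eqxx ?du ?dd ?dw //.
  by move=> _; rewrite leqNgt e3.
subst r s; have de : ndist H u e = 3 by apply/eqP; rewrite eqn_leq r3 e3.
exists u, a, b, c, d, e, w; split=> //; split.
- by rewrite (_ : [set u; a; b] = [set a; u; b]) // [[set u; a]]setUC.
- by rewrite setUC setUA.
- by rewrite [[set c; d]]setUC.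
- by rewrite setUC setUA.
Qed.

(** A nonzero excess forces the chain, where all 21 distances are determined. The single pair at
    distance 4 counts once in each order, hence the bound 2, and 76 is twice the Wiener index 38. *)
Lemma excess_order7 (T : finType) (H : hypergraph T) :
  uniform 3 H -> hconnected H -> horder H = 7 ->
  let S := \sum_(u in hverts H) \sum_(w in hverts H) (ndist H u w - 3) in
  S = 0 \/ S <= 2 /\ ndist_sum H = 76.
Proof.
move=> un con ord S.
have [->|S0] := eqVneq S 0; [by left | right].
have ex : exists u w, [/\ u \in hverts H, w \in hverts H & 3 < ndist H u w].
  move: S0; rewrite sum_nat_eq0 negb_forall => /existsP[u].
  rewrite negb_imply sum_nat_eq0 negb_forall => /andP[uV /existsP[w]].
  by rewrite negb_imply subn_eq0 -ltnNge => /andP[wV ?]; exists u, w.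
have [u [a [b [c [d [e [w [us Vs [da db dc dd de] dw [E1 E2 E3 E4]]]]]]]]] :=
  diameter4_order7 un con ord ex.
have bigE (F : T -> nat) : \sum_(x in hverts H) F x =
    \sum_(x <- [:: u; a; b; c; d; e; w]) F x.
  by rewrite (eq_bigl _ _ Vs) big_uniq.
rewrite /S /ndist_sum; do 2!rewrite !bigE !big_cons !big_nil.
have inV x : x \in [:: u; a; b; c; d; e; w] -> x \in hverts H by rewrite Vs.
have [[uV aV bV] [cV dV eV wV]] :
    [/\ u \in hverts H, a \in hverts H & b \in hverts H] /\
    [/\ c \in hverts H, d \in hverts H, e \in hverts H & w \in hverts H].
  by do 2!split; apply: inV; rewrite !inE eqxx ?orbT.
have tri x y z := @ndist_triangle _ _ con x y z.
have gt0 x y := @ndist_gt0 _ _ con x y.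
have ab : ndist H a b = 1.
  apply/eqP; rewrite eqn_leq gt0 ?(edge_ndist_le E1) ?inE ?eqxx ?orbT //.
  by move: us; rewrite /= !inE !negb_or => /and3P[_ /andP[]].
have de' : ndist H d e = 1.
  apply/eqP; rewrite eqn_leq gt0 ?(edge_ndist_le E3) ?inE ?eqxx ?orbT //.
  by move: us; rewrite /= !inE !negb_or => /and5P[_ _ _ _ /andP[/andP[]]].
have ac1 : ndist H a c <= 1 by rewrite (edge_ndist_le E2) // !inE eqxx ?orbT.
have bc1 : ndist H b c <= 1 by rewrite (edge_ndist_le E2) // !inE eqxx ?orbT.
have cd1 : ndist H c d <= 1 by rewrite (edge_ndist_le E3) // !inE eqxx ?orbT.
have ce1 : ndist H c e <= 1 by rewrite (edge_ndist_le E3) // !inE eqxx ?orbT.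
have dw1 : ndist H d w <= 1 by rewrite (edge_ndist_le E4) // !inE eqxx ?orbT.
have ew1 : ndist H e w <= 1 by rewrite (edge_ndist_le E4) // !inE eqxx ?orbT.
(* Two vertices are at least as far apart as their layers, so an upper bound equal to the layer
   difference fixes their distance. *)
have lvl x y k l : x \in hverts H -> y \in hverts H ->
    ndist H u x = k -> ndist H u y = k + l -> ndist H x y <= l ->
    ndist H x y = l /\ ndist H y x = l.
  move=> xV yV dx dy xy; rewrite (ndistC _ y x); suff -> : ndist H x y = l by [].
  apply/eqP; rewrite eqn_leq xy -(leq_add2l k) -dy -dx.
  exact: tri.
have [Eac Eca] := lvl a c 1 1 aV cV da dc ac1.
have [Ebc Ecb] := lvl b c 1 1 bV cV db dc bc1.
have [Ecd Edc] := lvl c d 2 1 cV dV dc dd cd1.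
have [Ece Eec] := lvl c e 2 1 cV eV dc de ce1.
have [Edw Ewd] := lvl d w 3 1 dV wV dd dw dw1.
have [Eew Ewe] := lvl e w 3 1 eV wV de dw ew1.
have two x y z : x \in hverts H -> y \in hverts H -> z \in hverts H ->
    ndist H x y = 1 -> ndist H y z = 1 -> ndist H x z <= 2.
  by move=> xV yV zV xy yz; have := tri y x z xV yV zV; rewrite xy yz.
have [Ead Eda] := lvl a d 1 2 aV dV da dd (two _ _ _ aV cV dV Eac Ecd).
have [Eae Eea] := lvl a e 1 2 aV eV da de (two _ _ _ aV cV eV Eac Ece).
have [Ebd Edb] := lvl b d 1 2 bV dV db dd (two _ _ _ bV cV dV Ebc Ecd).
have [Ebe Eeb] := lvl b e 1 2 bV eV db de (two _ _ _ bV cV eV Ebc Ece).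
have [Ecw Ewc] := lvl c w 2 2 cV wV dc dw (two _ _ _ cV dV wV Ecd Edw).
have aw3 : ndist H a w <= 3 by have := tri c a w aV cV wV; rewrite Eac Ecw.
have bw3 : ndist H b w <= 3 by have := tri c b w bV cV wV; rewrite Ebc Ecw.
have [Eaw Ewa] := lvl a w 1 3 aV wV da dw aw3.
have [Ebw Ewb] := lvl b w 1 3 bV wV db dw bw3.
rewrite !ndistxx (ndistC _ a u) (ndistC _ b u) (ndistC _ c u) (ndistC _ d u).
rewrite (ndistC _ e u) (ndistC _ w u) (ndistC _ b a) (ndistC _ e d).
rewrite da db dc dd de dw ab de' Eac Eca Ebc Ecb Ecd Edc Ece Eec Edw Ewd Eew Ewe.
by rewrite Ead Eda Eae Eea Ebd Edb Ebe Eeb Ecw Ewc Eaw Ewa Ebw Ewb.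
Qed.

(** * Double counting over the vertex deletions at order 8 *)

Section Order8.
Variables (T : finType) (H : hypergraph T).
Hypotheses (un : uniform 3 H) (con : hconnected H) (ord : horder H = 8).
Let V := hverts H.
Let D v u w := ndist (hdel H v) u w.

Lemma hdel_edge v e : e \in hedges H -> v \notin e -> e \in hedges (hdel H v).
Proof. by move=> eH ve; rewrite inE eH. Qed.

(** [C] holds the vertices whose deletion may break a chosen walk of length [k]. Each of the six
    deletions costs at most [k], and one in [C] at most [3 - k] more thanks to the truncation. *)
Lemma sum_del_le (u w : T) (C : {set T}) k : k <= 3 ->
  u \in V -> w \in V -> u != w ->
  {in V :\ u :\ w, forall v, v \notin C -> D v u w <= k} ->
  \sum_(v in V :\ u :\ w) minn 3 (D v u w) <= 6 * k + #|C| * (3 - k).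
Proof.
move=> k3 uV wV uw Dk.
have c6 : #|V :\ u :\ w| = 6.
  by apply: cardsD1_in; [apply: cardsD1_in | rewrite !inE eq_sym uw].
apply: (@leq_trans (\sum_(v in V :\ u :\ w) (k + (v \in C) * (3 - k)))).
  by apply: leq_sum => v vV; have := Dk v vV; case: (v \in C) => /=; lia.
rewrite big_split /= sum_nat_const c6 leq_add2l -big_distrl /= leq_mul2r.
apply/orP; right; rewrite -sum1_card [leqLHS]big_mkcond [leqRHS]big_mkcond.
by apply: leq_sum => v _; do 2!case: ifP.
Qed.

(** With two common hyperedges the sum is at most 6, and [6 + 2 <= 7 * d + 1]. Otherwise distance 1
    has one critical vertex, giving [6 + 2 = 7 + 1]; distance 2 has at most three, giving
    [12 + 3 = 14 + 1]; from distance 3 on, truncation gives 18, below 22. *)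
Lemma sum_del_le_pair (u w : T) : u \in V -> w \in V -> u != w ->
  \sum_(v in V :\ u :\ w) minn 3 (D v u w) + 2 * (1 < codegree H u w)
    <= 7 * ndist H u w + 1.
Proof.
move=> uV wV uw; have d0 := ndist_gt0 con uV wV uw.
case: ltnP => [/card_gt1P[e [e' []]]|cd].
  rewrite !inE => /and3P[eH ue we] /and3P[e'H ue' we'] nee'.
  have := @sum_del_le u w set0 1 isT uV wV uw.
  rewrite cards0 mul0n => H6; have : 6 + 2 <= 7 * ndist H u w + 1 by lia.
  apply: leq_trans; rewrite leq_add2r; apply: H6 => v.
  rewrite !inE => /and3P[vw vu vV] _.
  have [ve|ve] := boolP (v \in e); last first.
    exact: edge_ndist_le (hdel_edge eH ve) ue we.
  have [ve'|ve'] := boolP (v \in e'); last first.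
    exact: edge_ndist_le (hdel_edge e'H ve') ue' we'.
  (* A hyperedge containing [u], [w] and [v] is determined by them, so deleting [v] cannot destroy
     both [e] and [e']. *)
  have Euwv g : g \in hedges H -> u \in g -> w \in g -> v \in g -> g = [set u; w; v].
    move=> gH ug wg; have [z [-> _ _]] := uniform3_third un gH uw ug wg.
    by rewrite !inE (negPf vw) (negPf vu) /= => /eqP->.
  by rewrite (Euwv e) // (Euwv e') ?eqxx in nee'.
rewrite muln0 addn0.
case E: (ndist H u w) d0 => [|[|[|n]]] // _.
- case/existsP: (ndist1_hadj con uV wV E) => e /and3P[eH ue we].
  have [z [Ee _ _]] := uniform3_third un eH uw ue we.
  have := @sum_del_le u w [set z] 1 isT uV wV uw; rewrite cards1; apply.
  move=> v; rewrite !inE => /and3P[vw vu vV] vz.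
  apply: edge_ndist_le (hdel_edge eH _) ue we.
  by rewrite Ee !inE !negb_or vu vw vz.
- have [x ux xw] := ndist_pred con uV wV E.
  have [xV _] := andP (hadj_verts xw).
  case/existsP: (ndist1_hadj con uV xV ux) => e /and3P[eH ue xe].
  case/existsP: xw => e' /and3P[e'H xe' we'].
  have nux : u != x by apply/eqP=> Eu; move: ux; rewrite Eu ndistxx.
  have nxw : x != w by apply/eqP=> Eu; move: ux; rewrite Eu E.
  have [a [Ee _ _]] := uniform3_third un eH nux ue xe.
  have [b [Ee' _ _]] := uniform3_third un e'H nxw xe' we'.
  have c3 : #|[set x; a; b]| <= 3 by rewrite (leq_trans (leq_card_setU _ _)) // cards2 cards1; case: eqP.
  have le := @sum_del_le u w [set x; a; b] 2 isT uV wV uw.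
  apply: (@leq_trans (6 * 2 + #|[set x; a; b]| * (3 - 2))); last by lia.
  apply: le => v; rewrite !inE !negb_or => /and3P[vw vu vV] /andP[/andP[vx va] vb].
  apply/walk_ndist_le/(@walk_cat _ _ 1 1 _ x).
    by apply: walk1 (hdel_edge eH _) ue xe; rewrite Ee !inE !negb_or vu vx va.
  by apply: walk1 (hdel_edge e'H _) xe' we'; rewrite Ee' !inE !negb_or vx vw vb.
- have := @sum_del_le u w setT 3 isT uV wV uw.
  rewrite subnn muln0 addn0 => le; apply: (@leq_trans (6 * 3)); last by lia.
  by apply: le => v _; rewrite inE.
Qed.

Lemma uniform_hdel v : uniform 3 (hdel H v).
Proof. by move=> e; rewrite inE => /andP[eH _]; apply: un. Qed.

(* Counting the pairs (w, e) with u, w in e would give 7 = 2 deg u. *)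
Lemma codegree_neq1 : ~ (forall u w, u \in V -> w \in V -> u != w ->
  codegree H u w = 1).
Proof.
move=> cd; have /card_gt0P[u uV] : 0 < #|V| by rewrite [#|V|]ord.
have c7 : \sum_(w in V :\ u) codegree H u w = 7.
  rewrite -[RHS](cardsD1_in ord uV) -sum1_card; apply: eq_bigr => w.
  by rewrite !inE eq_sym => /andP[wu wV]; apply: cd.
move: c7; under eq_bigr do rewrite /codegree -sum1dep_card.
rewrite (exchange_big_dep [pred e in hedges H | u \in e]) /=; last first.
  by move=> w e _ /and3P[-> ->].
rewrite (eq_bigr (fun=> 2)); first by rewrite sum_nat_const; lia.
move=> e /andP[eH ue]; rewrite sum1dep_card -[RHS](cardsD1_in (un eH) ue).
apply: eq_card => w; rewrite !inE eH ue /= -andbA; congr andb.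
case we: (w \in e); rewrite ?andbF ?andbT //.
by apply: (subsetP _ _ we); rewrite -powersetE (subsetP (hedges_sub H)).
Qed.

Lemma not_soltes_order8 : ~ soltes H.
Proof.
case=> _ sol; have [N EN] := hconnected_wiener con.
have [_ EM] := wiener_Some EN.
have del v : v \in V -> hconnected (hdel H v) /\ ndist_sum (hdel H v) = N.*2.
  by move=> vV; apply: wiener_Some; rewrite sol.
pose S v := \sum_(u in V :\ v) \sum_(w in V :\ v) (D v u w - 3).
pose m v := \sum_(u in V :\ v) \sum_(w in V :\ v) minn 3 (D v u w).
have split v : v \in V -> m v + S v = N.*2.
  move=> vV; have [_ <-] := del v vV; rewrite -big_split /=.
  apply: eq_bigr => u _; rewrite -big_split /=; apply: eq_bigr => w _.
  by rewrite /D; lia.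
(* Regrouped by pairs: each ordered pair of distinct vertices survives the deletion of the six
   others, and diagonal terms vanish. *)
have Em : \sum_(v in V) m v =
    \sum_(u in V) \sum_(w in V :\ u) \sum_(v in V :\ u :\ w) minn 3 (D v u w).
  rewrite (exchange_big_dep (mem V)) /=; last by move=> v u _; rewrite inE => /andP[].
  apply: eq_bigr => u uV.
  rewrite (exchange_big_dep (mem V)) /=; last by move=> v w _; rewrite inE => /andP[].
  rewrite (bigD1 u) //= big1 ?add0n; last by move=> v _; rewrite /D ndistxx.
  apply: eq_big => [w|w /andP[wV _]]; first by rewrite !inE andbC.
  apply: eq_bigl => v; rewrite !inE uV wV !andbT andbC (eq_sym v w) (eq_sym v u).
  by rewrite [(v \in V) && _]andbC.
have c8 : #|V| = 8 := ord.
have tot : 8 * N.*2 = \sum_(v in V) m v + \sum_(v in V) S v.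
  by rewrite -big_split /= (eq_bigr _ split) sum_nat_const c8.
pose B := \sum_(u in V) \sum_(w in V :\ u) (1 < codegree H u w : nat).
have EM' : N.*2 = \sum_(u in V) \sum_(w in V :\ u) ndist H u w.
  rewrite -EM; apply: eq_bigr => u uV; rewrite (bigD1 u) //= ndistxx add0n.
  by apply: eq_bigl => w; rewrite !inE andbC.
have E56 : \sum_(u in V) \sum_(w in V :\ u) 1 = 56.
  rewrite (eq_bigr (fun=> 7)) ?sum_nat_const ?c8 // => u uV.
  by rewrite sum1_card (cardsD1_in ord uV).
have upper : \sum_(v in V) m v + 2 * B <= 7 * N.*2 + 56.
  rewrite Em /B EM' -E56 !big_distrr -!big_split /=; apply: leq_sum => u uV.
  rewrite !big_distrr -!big_split /=; apply: leq_sum => w.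
  by rewrite !inE eq_sym => /andP[uw wV]; apply: sum_del_le_pair.
have Sex v : v \in V -> S v = 0 \/ S v <= 2 /\ N.*2 = 76.
  move=> vV; have [conv <-] := del v vV.
  exact: (excess_order7 (@uniform_hdel v) conv (cardsD1_in ord vV)).
have [/exists_inP[v vV Sv]|] := boolP [exists v in V, S v != 0].
  have N76 : N.*2 = 76 by case: (Sex v vV) Sv => [->|[]].
  have : \sum_(v in V) S v <= \sum_(v in V) 2.
    by apply: leq_sum => x xV; case: (Sex x xV) => [->|[]].
  (* The total [8 * 76 = 608] would be at most [7 * 76 + 56 + 16 = 604]. *)
  rewrite sum_nat_const c8; lia.
rewrite negb_exists_in => /forall_inP S0.
have {}S0 : \sum_(v in V) S v = 0.
  by rewrite big1 // => v /S0; rewrite negbK => /eqP.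
(* Without excess, [upper] reads [N.*2 + 2 * B <= 56]. Pairwise, distance 1 forces a common
   hyperedge, and a second one adds 2 through [B]; a larger distance already pays for a codegree
   other than 1. So every codegree is 1. *)
have : N.*2 + 2 * B >=
    56 + \sum_(u in V) \sum_(w in V :\ u) (codegree H u w != 1 : nat).
  rewrite /B EM' -E56 !big_distrr -!big_split /=; apply: leq_sum => u uV.
  rewrite !big_distrr -!big_split /=; apply: leq_sum => w.
  rewrite !inE eq_sym => /andP[uw wV]; have := ndist_gt0 con uV wV uw.
  case: (ndist H u w =P 1) => [d1|]; last by lia.
  have : 0 < codegree H u w; last by lia.
  case/existsP: (ndist1_hadj con uV wV d1) => e eP.
  by apply/card_gt0P; exists e; rewrite inE.
move=> lower; have {}lower :
    \sum_(u in V) \sum_(w in V :\ u) (codegree H u w != 1 : nat) = 0 by lia.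
apply: codegree_neq1 => u w uV wV uw; apply/eqP.
move/eqP: lower; rewrite sum_nat_eq0 => /forall_inP/(_ u uV).
rewrite sum_nat_eq0 => /forall_inP/(_ w).
by rewrite !inE eq_sym uw wV => /(_ isT); rewrite eqb0 negbK.
Qed.

End Order8.

Theorem mainTheorem5 :
  ~ exists (T : finType) (H : hypergraph T),
      [/\ uniform 3 H, horder H = 8 & soltes H].
Proof.
case=> T [H [un ord sol]]; have [con _] := sol.
exact: not_soltes_order8 un con ord sol.
Qed.
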